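(* Let $T\colon\mathsf{Set}\to\mathsf{Set}$ be a functor, let $L$ be a finitarily separable nonexpansive fuzzy lax extension of $T$, fix a finitary presentation of $T_\omega$ with signature $\Sigma$, and let $\Lambda=\{\mu^\sigma\mid\sigma\in\Sigma\}$ be the set of Moss liftings of $L$. Then $d^L=d^\Lambda$, i.e. for all $T$-coalgebras $\alpha\colon A\to TA$, $\beta\colon B\to TB$ and all $a\in A$, $b\in B$, the $L$-behavioural distance $d^L_{\alpha,\beta}(a,b)$ equals the $\Lambda$-logical distance $d^\Lambda(a,b)$.
   Context: A fuzzy relation between sets $A$ and $B$ is a map $R\colon A\times B\to[0,1]$; fuzzy relations are ordered pointwise, and the converse is $R^\circ(b,a)=R(a,b)$. For $x,y\in[0,1]$: $x\oplus y=\min(x+y,1)$, $x\ominus y=\max(x-y,0)$. Composition: $(R;S)(a,c)=\inf_{b\in B}R(a,b)\oplus S(b,c)$ (infima and suprema are taken in $[0,1]$). For $f\colon A\to B$ and $\epsilon\in[0,1]$, $\mathrm{Gr}_{\epsilon,f}(a,b)=\epsilon$ if $f(a)=b$ and $1$ otherwise; $\mathrm{Gr}_f=\mathrm{Gr}_{0,f}$, $\Delta_{\epsilon,A}=\mathrm{Gr}_{\epsilon,\mathrm{id}_A}$, $\Delta_A=\Delta_{0,A}$. A fuzzy lax extension $L$ of $T$ assigns to each fuzzy relation $R$ between $A$ and $B$ (for all sets $A,B$) a fuzzy relation $LR$ between $TA$ and $TB$ such that (L1) $R_1\le R_2$ implies $LR_1\le LR_2$; (L2) $L(R;S)\le LR;LS$;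 (L3) $L\,\mathrm{Gr}_f\le\mathrm{Gr}_{Tf}$ and $L(\mathrm{Gr}_f^\circ)\le\mathrm{Gr}_{Tf}^\circ$ for every function $f$. It is nonexpansive if $L\Delta_{\epsilon,A}\le\Delta_{\epsilon,TA}$ for all sets $A$ and all $\epsilon>0$. $T_\omega X=\bigcup\{Ti[TY]\mid Y\subseteq X\text{ finite}, i\colon Y\to X\text{ inclusion}\}\subseteq TX$ (a subfunctor of $T$). $L$ is finitarily separable if for every set $X$, every $t\in TX$ and every $\epsilon>0$ there is $s\in T_\omega X$ with $L\Delta_X(t,s)\le\epsilon$ and $L\Delta_X(s,t)\le\epsilon$. A finitary presentation of $T_\omega$ consists of a signature $\Sigma$ of operations with given finite arities and, for each $n$-ary $\sigma\in\Sigma$, a natural transformation $\sigma\colon(-)^n\Rightarrow T_\omega$, such that every element of $T_\omega X$ has the form $\sigma_X(x_1,\dots,x_n)$ for some $\sigma\in\Sigma$ and $x_1,\dots,x_n\in X$. Write $\mathcal{Q}X$ for the set of functions $X\to[0,1]$ (a contravariant functor by precomposition). An $n$-ary predicate lifting is a natural transformation $\lambda\colon\mathcal{Q}^n\Rightarrow\mathcal{Q}\circ T$. Let $\in_X$ be the fuzzy relation between $X$ and $\mathcal{Q}X$ given by $\in_X(x,f)=f(x)$. For $n$-ary $\sigma\in\Sigma$, the Moss lifting $\mu^\sigma$ is the $n$-ary predicate lifting $\mu^\sigma_X(f_1,\dots,f_n)(t)=(L{\in_X})(t,\sigma_{\mathcal{Q}X}(f_1,\dots,f_n))$ for $t\in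 TX$. Behavioural distance: for coalgebras $\alpha\colon A\to TA$, $\beta\colon B\to TB$, an $L$-simulation is a fuzzy relation $R$ between $A$ and $B$ with $LR(\alpha(a),\beta(b))\le R(a,b)$ for all $a,b$; $d^L_{\alpha,\beta}$ is the pointwise infimum of all $L$-simulations between $A$ and $B$. Logic: for a set $\Lambda$ of predicate liftings, the formulae $\mathcal{L}_\Lambda$ are given by the grammar $\phi,\psi::=c\mid\phi\ominus c\mid\phi\oplus c\mid\phi\land\psi\mid\phi\lor\psi\mid\lambda(\phi_1,\dots,\phi_n)$ with $c\in\mathbb{Q}\cap[0,1]$ and $\lambda\in\Lambda$ $n$-ary. In a coalgebra $(A,\alpha)$, $[\![\phi]\!]\colon A\to[0,1]$ is defined by interpreting $c$ as a constant, $\ominus c$ and $\oplus c$ as the truncated operations above, $\land$ and $\lor$ as pointwise minimum and maximum, and $[\![\lambda(\phi_1,\dots,\phi_n)]\!](a)=\lambda_A([\![\phi_1]\!],\dots,[\![\phi_n]\!])(\alpha(a))$. The $\Lambda$-logical distance is $d^\Lambda(a,b)=\sup\{[\![\phi]\!](a)\ominus[\![\phi]\!](b)\mid\phi\in\mathcal{L}_\Lambda\}$ (evaluated in the respective coalgebras). *)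

(* Defs.v *)
From HB Require Import structures.
From mathcomp Require Import all_boot all_order all_algebra.
From mathcomp Require Import mathcomp_extra boolp classical_sets functions.
From mathcomp Require Import cardinality reals interval_inference.

Set Implicit Arguments.
Unset Strict Implicit.
Unset Printing Implicit Defensive.
Import Order.TTheory GRing.Theory Num.Theory.
Local Open Scope classical_set_scope.
Local Open Scope ring_scope.

(* One fixed universe, so that functors below are endofunctors of the
   category of sets (types in this universe) and functions. *)
Definition SET := Type.

Section UnitInterval.
Variable R : realType.
Implicit Types (x y : {i01 R}) (S : set {i01 R}).

Definition oplus x y : {i01 R} := (Num.min (x%:num + y%:num) 1)%:i01.
Definition ominus x y : {i01 R} := (Num.max (x%:num - y%:num) 0)%:i01.

(* Infima and suprema are taken in [0,1]: the infimum of the empty set is 1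
   and its supremum is 0.  Adjoining 1 (resp. 0) achieves this and changes
   nothing for nonempty sets. *)
Let inf_set S : set R := [set x%:num | x in S] `|` [set 1].
Let sup_set S : set R := [set x%:num | x in S] `|` [set 0].

Fact inf_set_lb S : lbound (inf_set S) 0.
Proof. by move=> _ [[x _ <-]|->]. Qed.

Fact sup_set_ub S : ubound (sup_set S) 1.
Proof. by move=> _ [[x _ <-]|->]. Qed.

Fact inf01_ge0 S : 0 <= inf (inf_set S).
Proof. by apply: lb_le_inf; [exists 1; right | exact: inf_set_lb]. Qed.

Fact inf01_le1 S : inf (inf_set S) <= 1.
Proof. by apply: ge_inf; [exists 0; exact: inf_set_lb | right]. Qed.

Fact sup01_ge0 S : 0 <= sup (sup_set S).
Proof. by apply: ub_le_sup; [exists 1; exact: sup_set_ub | right]. Qed.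

Fact sup01_le1 S : sup (sup_set S) <= 1.
Proof. by apply: ge_sup; [exists 0; right | exact: sup_set_ub]. Qed.

Definition inf01 S : {i01 R} := Itv01 (inf01_ge0 S) (inf01_le1 S).
Definition sup01 S : {i01 R} := Itv01 (sup01_ge0 S) (sup01_le1 S).

Lemma ge_inf01 S x : S x -> inf01 S <= x.
Proof.
move=> Sx; suff: inf (inf_set S) <= x%:num by [].
by apply: ge_inf; [exists 0; exact: inf_set_lb | left; exists x].
Qed.

Lemma le_inf01 S x : (forall y, S y -> x <= y) -> x <= inf01 S.
Proof.
move=> xS; suff: x%:num <= inf (inf_set S) by [].
apply: lb_le_inf; first by exists 1; right.
by move=> _ [[y Sy <-]|->] //; exact: xS.
Qed.

Lemma le_sup01 S x : S x -> x <= sup01 S.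
Proof.
move=> Sx; suff: x%:num <= sup (sup_set S) by [].
by apply: ub_le_sup; [exists 1; exact: sup_set_ub | left; exists x].
Qed.

Lemma ge_sup01 S x : (forall y, S y -> y <= x) -> sup01 S <= x.
Proof.
move=> Sx; suff: sup (sup_set S) <= x%:num by [].
apply: ge_sup; first by exists 0; right.
by move=> _ [[y Sy <-]|->] //; exact: Sx.
Qed.

Fact ratr01_ge0 (c : {i01 rat}) : 0 <= ratr c%:num :> R.
Proof. by rewrite ler0q. Qed.

Fact ratr01_le1 (c : {i01 rat}) : ratr c%:num <= 1 :> R.
Proof. by rewrite -(rmorph1 (@ratr R)) ler_rat. Qed.

Definition ratr01 (c : {i01 rat}) : {i01 R} :=
  Itv01 (ratr01_ge0 c) (ratr01_le1 c).

Lemma oplusC x y : oplus x y = oplus y x.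
Proof. by apply/val_inj; rewrite /= addrC. Qed.

Lemma oplus0 x : oplus x 0%:i01 = x.
Proof. by apply/val_inj; rewrite /= addr0; apply/min_idPl. Qed.

Lemma oplus1 x : oplus x 1%:i01 = 1%:i01.
Proof. by apply/val_inj => /=; apply/min_idPr; rewrite lerDr. Qed.

Lemma i01_anti x y : x <= y -> y <= x -> x = y.
Proof. by move=> xy yx; apply: le_anti; rewrite xy yx. Qed.

Lemma le_i01 x : x <= 1%:i01.
Proof. by suff: x%:num <= 1 by []. Qed.

Lemma le_oplus x x' y y' : x <= x' -> y <= y' -> oplus x y <= oplus x' y'.
Proof.
move=> xx' yy'.
suff: Num.min (x%:num + y%:num) 1 <= Num.min (x'%:num + y'%:num) 1 by [].
by rewrite le_min !ge_min lexx orbT andbT lerD.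
Qed.

End UnitInterval.

Section FuzzyRelations.
Variable R : realType.

Definition fuzzy_rel (A B : SET) := A -> B -> {i01 R}.

Definition le_fuzzy (A B : SET) (r s : fuzzy_rel A B) := forall a b, r a b <= s a b.

Definition conv_fuzzy (A B : SET) (r : fuzzy_rel A B) : fuzzy_rel B A := fun b a => r a b.

Definition comp_fuzzy (A B C : SET) (r : fuzzy_rel A B) (s : fuzzy_rel B C) : fuzzy_rel A C :=
  fun a c => inf01 [set oplus (r a b) (s b c) | b in [set: B]].

Definition Gr_eps (A B : SET) (e : {i01 R}) (f : A -> B) : fuzzy_rel A B :=
  fun a b => if `[< f a = b >] then e else 1%:i01.

Definition Gr (A B : SET) (f : A -> B) : fuzzy_rel A B := Gr_eps 0%:i01 f.

Definition Delta_eps (e : {i01 R}) (A : SET) : fuzzy_rel A A := Gr_eps e (@idfun A).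

Arguments Delta_eps e A : clear implicits.

Definition Delta (A : SET) : fuzzy_rel A A := Delta_eps 0%:i01 A.

Arguments Delta A : clear implicits.

Definition Q (X : SET) : SET := X -> {i01 R}.

Definition elem_fuzzy (X : SET) : fuzzy_rel X (Q X) := fun x f => f x.

Lemma ge_comp_fuzzy (A B C : SET) (r : fuzzy_rel A B) (s : fuzzy_rel B C) a b c :
  comp_fuzzy r s a c <= oplus (r a b) (s b c).
Proof. by apply: ge_inf01; exists b. Qed.

Lemma le_comp_fuzzy (A B C : SET) (r : fuzzy_rel A B) (s : fuzzy_rel B C) a c x :
  (forall b, x <= oplus (r a b) (s b c)) -> x <= comp_fuzzy r s a c.
Proof. by move=> xrs; apply: le_inf01 => _ [b _ <-]. Qed.

Lemma GrE (A B : SET) (f : A -> B) a : Gr f a (f a) = 0%:i01.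
Proof. by rewrite /Gr /Gr_eps asboolT. Qed.

Lemma Gr_neq (A B : SET) (f : A -> B) a b : f a <> b -> Gr f a b = 1%:i01.
Proof. by move=> fab; rewrite /Gr /Gr_eps asboolF. Qed.

Lemma Gr_compl (A B C : SET) (f : A -> B) (r : fuzzy_rel B C) a c :
  comp_fuzzy (Gr f) r a c = r (f a) c.
Proof.
apply: i01_anti.
  by rewrite (le_trans (ge_comp_fuzzy _ _ _ (f a) _))// GrE oplusC oplus0.
apply: le_comp_fuzzy => b; have [<-|fab] := pselect (f a = b).
  by rewrite GrE oplusC oplus0.
by rewrite Gr_neq// oplusC oplus1 le_i01.
Qed.

Lemma Gr_compr (A B C : SET) (g : C -> B) (r : fuzzy_rel A B) a c :
  comp_fuzzy r (conv_fuzzy (Gr g)) a c = r a (g c).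
Proof.
apply: i01_anti.
  by rewrite (le_trans (ge_comp_fuzzy _ _ _ (g c) _))// /conv_fuzzy GrE oplus0.
apply: le_comp_fuzzy => b; rewrite /conv_fuzzy.
have [<-|gcb] := pselect (g c = b); first by rewrite GrE oplus0.
by rewrite Gr_neq// oplus1 le_i01.
Qed.

End FuzzyRelations.

Arguments Delta_eps {R} e A.
Arguments Delta R A : clear implicits.
Arguments elem_fuzzy R X : clear implicits.

Record set_functor := SetFunctor {
  fobj :> SET -> SET;
  fmap : forall A B : SET, (A -> B) -> fobj A -> fobj B;
  fmap_id : forall (A : SET) (t : fobj A), fmap (@idfun A) t = t;
  fmap_comp : forall (A B C : SET) (g : B -> C) (f : A -> B) (t : fobj A),
    fmap (g \o f) t = fmap g (fmap f t) }.

Arguments fmap F {A B} f t : rename.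

Record nat_trans (F G : set_functor) := NatTrans {
  nt :> forall X : SET, F X -> G X;
  nt_natural : forall (X Y : SET) (f : X -> Y) (t : F X),
    nt (fmap F f t) = fmap G f (nt t) }.

(* The functor X |-> X^n, with n-tuples encoded as functions on 'I_n. *)
Definition pow_functor (n : nat) : set_functor :=
  @SetFunctor (fun X => 'I_n -> X) (fun A B f x => f \o x)
    (fun A t => erefl) (fun A B C g f t => erefl).

Section FinitaryPart.
Variable T : set_functor.

Definition Tfin (X : SET) : set (T X) :=
  \bigcup_(Y in [set Y : set X | finite_set Y])
    range (fmap T (@proj1_sig X Y)).

Lemma Tfin_fmap (X Y : SET) (f : X -> Y) (t : T X) :
  Tfin t -> Tfin (fmap T f t).
Proof.
move=> [Z /= Zfin [s _ <-]]; exists (f @` Z); first exact: finite_image.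
have fZ (z : {x : X | Z x}) : (f @` Z) (f (sval z)).
  by exists (sval z) => //; exact: svalP.
pose g z : {y : Y | (f @` Z) y} := exist _ (f (sval z)) (fZ z).
by exists (fmap T g s) => //; rewrite -!fmap_comp.
Qed.

Definition Tomega_obj (X : SET) : SET := {t : T X | Tfin t}.

Lemma Tomega_inj (X : SET) (s t : Tomega_obj X) : sval s = sval t -> s = t.
Proof. by move: s t => [s ps] [t pt] /= st; exact: eq_exist. Qed.

Definition Tomega_fmap (X Y : SET) (f : X -> Y) (t : Tomega_obj X) :
    Tomega_obj Y :=
  exist _ (fmap T f (sval t)) (Tfin_fmap f (svalP t)).

Fact Tomega_fmap_id (X : SET) (t : Tomega_obj X) : Tomega_fmap (@idfun X) t = t.
Proof. by apply: Tomega_inj; rewrite /= fmap_id. Qed.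

Fact Tomega_fmap_comp (X Y Z : SET) (g : Y -> Z) (f : X -> Y)
    (t : Tomega_obj X) :
  Tomega_fmap (g \o f) t = Tomega_fmap g (Tomega_fmap f t).
Proof. by apply: Tomega_inj; rewrite /= fmap_comp. Qed.

Definition Tomega : set_functor :=
  SetFunctor Tomega_fmap_id Tomega_fmap_comp.

Definition Tomega_incl (X : SET) (t : Tomega X) : T X := sval t.

Record finitary_presentation := FinitaryPresentation {
  operation : SET;
  arity : operation -> nat;
  interp : forall o : operation, nat_trans (pow_functor (arity o)) Tomega;
  interp_surj : forall (X : SET) (t : Tomega X),
    exists (o : operation) (x : 'I_(arity o) -> X), t = interp o X x }.

End FinitaryPart.

Section LaxExtensions.
Variables (R : realType) (T : set_functor).

Record lax_extension := LaxExtension {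
  lax : forall A B : SET, fuzzy_rel R A B -> fuzzy_rel R (T A) (T B);
  lax_le : forall (A B : SET) (r1 r2 : fuzzy_rel R A B),
    le_fuzzy r1 r2 -> le_fuzzy (lax r1) (lax r2);
  lax_comp : forall (A B C : SET) (r : fuzzy_rel R A B) (s : fuzzy_rel R B C),
    le_fuzzy (lax (comp_fuzzy r s)) (comp_fuzzy (lax r) (lax s));
  lax_Gr : forall (A B : SET) (f : A -> B),
    le_fuzzy (lax (Gr R f)) (Gr R (fmap T f));
  lax_conv_Gr : forall (A B : SET) (f : A -> B),
    le_fuzzy (lax (conv_fuzzy (Gr R f))) (conv_fuzzy (Gr R (fmap T f))) }.

Variable L : lax_extension.

Definition nonexpansive :=
  forall (A : SET) (e : {i01 R}), 0%:i01 < e ->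
    le_fuzzy (lax L (Delta_eps e A)) (Delta_eps e (T A)).

Definition finitarily_separable :=
  forall (X : SET) (t : T X) (e : R), 0 < e ->
    exists s : Tomega T X,
      (lax L (Delta R X) t (Tomega_incl s))%:num <= e /\
      (lax L (Delta R X) (Tomega_incl s) t)%:num <= e.

Lemma lax_natural (A A' B B' : SET) (f : A -> A') (g : B -> B')
    (r : fuzzy_rel R A' B') t s :
  lax L (fun a b => r (f a) (g b)) t s = lax L r (fmap T f t) (fmap T g s).
Proof.
set r' : fuzzy_rel R A B := fun a b => _.
apply: i01_anti.
  have r'E : le_fuzzy r' (comp_fuzzy (Gr R f) (comp_fuzzy r (conv_fuzzy (Gr R g)))).
    by move=> a b; rewrite Gr_compl Gr_compr.
  apply: (le_trans (lax_le L r'E t s)).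
  apply: (le_trans (lax_comp L _ _ t s)).
  apply: (le_trans (ge_comp_fuzzy _ _ _ (fmap T f t) _)).
  rewrite -[leRHS]oplus0 oplusC; apply: le_oplus; last first.
    by rewrite -(GrE R (fmap T f) t); exact: lax_Gr.
  apply: (le_trans (lax_comp L _ _ _ s)).
  apply: (le_trans (ge_comp_fuzzy _ _ _ (fmap T g s) _)).
  rewrite -[leRHS]oplus0; apply: le_oplus => //.
  rewrite -(GrE R (fmap T g) s).
  exact: (lax_conv_Gr L g (fmap T g s) s).
have rE : le_fuzzy r (comp_fuzzy (conv_fuzzy (Gr R f)) (comp_fuzzy r' (Gr R g))).
  move=> a' b'; apply: le_comp_fuzzy => a.
  have [<-|fa] := pselect (f a = a'); last first.
    by rewrite /conv_fuzzy Gr_neq// oplusC oplus1 le_i01.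
  rewrite /conv_fuzzy GrE oplusC oplus0; apply: le_comp_fuzzy => b.
  have [<-|gb] := pselect (g b = b'); last by rewrite Gr_neq// oplus1 le_i01.
  by rewrite GrE oplus0.
apply: (le_trans (lax_le L rE _ _)).
apply: (le_trans (lax_comp L _ _ _ _)).
apply: (le_trans (ge_comp_fuzzy _ _ _ t _)).
rewrite -[leRHS]oplus0 oplusC; apply: le_oplus; last first.
  rewrite -(GrE R (fmap T f) t).
  exact: (lax_conv_Gr L f (fmap T f t) t).
apply: (le_trans (lax_comp L _ _ _ _)).
apply: (le_trans (ge_comp_fuzzy _ _ _ s _)).
rewrite -[leRHS]oplus0; apply: le_oplus => //.
by rewrite -(GrE R (fmap T g) s); exact: lax_Gr.
Qed.

Definition simulation (A B : SET) (alpha : A -> T A) (beta : B -> T B)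
    (r : fuzzy_rel R A B) :=
  forall a b, lax L r (alpha a) (beta b) <= r a b.

Definition behavioural_distance (A B : SET) (alpha : A -> T A)
    (beta : B -> T B) : fuzzy_rel R A B :=
  fun a b => inf01 [set r a b | r in simulation alpha beta].

Record predicate_lifting := PredicateLifting {
  pl_arity : nat;
  pl :> forall X : SET, ('I_pl_arity -> Q R X) -> Q R (T X);
  pl_natural : forall (X Y : SET) (h : X -> Y) (f : 'I_pl_arity -> Q R Y),
    pl (fun i => f i \o h) = pl f \o fmap T h }.

Section Moss.
Variables (P : finitary_presentation T) (o : operation P).

Definition moss_fun (X : SET) (f : 'I_(arity o) -> Q R X) : Q R (T X) :=
  fun t => lax L (elem_fuzzy R X) t (Tomega_incl (interp o _ f)).

Fact moss_natural (X Y : SET) (h : X -> Y) (f : 'I_(arity o) -> Q R Y) :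
  moss_fun (fun i => f i \o h) = moss_fun f \o fmap T h.
Proof.
apply/funext => t; rewrite /moss_fun /=.
pose Qh (g : Q R Y) : Q R X := g \o h.
rewrite (_ : Tomega_incl _ = fmap T Qh (Tomega_incl (interp o _ f))); last first.
  by have /(congr1 (@Tomega_incl T _)) := nt_natural (interp o) Qh f.
rewrite -[in LHS](fmap_id t).
rewrite -(lax_natural idfun Qh (elem_fuzzy R X)).
by rewrite -[in RHS](fmap_id (Tomega_incl _)) -(lax_natural h idfun (elem_fuzzy R Y)).
Qed.

Definition moss : predicate_lifting := PredicateLifting moss_natural.

End Moss.

(* Predicate liftings quantify over SET and are too large for the library's
   set, hence the plain predicate. *)
Definition moss_liftings (P : finitary_presentation T) :
    predicate_lifting -> Prop :=
  fun l => exists o : operation P, l = moss o.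

End LaxExtensions.

Section Logic.
Variables (R : realType) (T : set_functor).
Variable Lambda : predicate_lifting R T -> Prop.

Inductive formula :=
| FConst (c : {i01 rat})
| FMinus (phi : formula) (c : {i01 rat})
| FPlus (phi : formula) (c : {i01 rat})
| FAnd (phi psi : formula)
| FOr (phi psi : formula)
| FModal (l : predicate_lifting R T) (Ll : Lambda l)
    (phi : 'I_(pl_arity l) -> formula).

Fixpoint eval (A : SET) (alpha : A -> T A) (phi : formula) : A -> {i01 R} :=
  match phi with
  | FConst c => fun=> ratr01 R c
  | FMinus phi c => fun a => ominus (eval alpha phi a) (ratr01 R c)
  | FPlus phi c => fun a => oplus (eval alpha phi a) (ratr01 R c)
  | FAnd phi psi => fun a => Num.min (eval alpha phi a) (eval alpha psi a)
  | FOr phi psi => fun a => Num.max (eval alpha phi a) (eval alpha psi a)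
  | FModal l _ phi => fun a => l A (fun i => eval alpha (phi i)) (alpha a)
  end.

Definition logical_distance (A B : SET) (alpha : A -> T A) (beta : B -> T B) :
    fuzzy_rel R A B :=
  fun a b =>
    sup01 [set x | exists phi : formula,
      x = ominus (eval alpha phi a) (eval beta phi b)].

End Logic.

(* Main.v *)
Require Import Defs.
From mathcomp Require Import all_boot all_order all_algebra.
From mathcomp Require Import boolp classical_sets reals interval_inference lra.

(** Adequacy: by lax functoriality, a formula evaluated in [A] and in [B] gives
    relations [phi_A], [phi_B] with [phi_A <= r ; phi_B] for any simulation [r],
    and [L] preserves this inequality.

    Expressivity: the logical distance [d] is itself a simulation.  To bound
    [L d (t, t')], approximate both [t] and [t'] by finitary elements
    [s' = sigma' (x_1, ..., x_m)] and [s = sigma (y_1, ..., y_n)].  On the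
    finitely many pairs [(x_i, y_j)] the distance [d] is nearly attained by
    formulae [psi_j] with [psi_j (y_j) = 0], where [psi_j] is a finite
    disjunction of formulae of the form [phi - q].  The formula
    [mu^sigma (psi_1, ..., psi_n)] is then almost [0] at [t'], because the
    matrix [psi_j (y_i)] vanishes on the diagonal, whereas at [t] it is almost
    [L d (s', s)], hence almost [L d (t, t')]. *)

Set Implicit Arguments.
Unset Strict Implicit.
Unset Printing Implicit Defensive.
Import Order.TTheory GRing.Theory Num.Theory.
Local Open Scope classical_set_scope.
Local Open Scope ring_scope.

(** * Reduction to linear arithmetic over the reals *)

Section UnitIntervalArithmetic.
Variable R : realType.
Implicit Types x y z : {i01 R}.

Lemma i01_leE x y : (x <= y) = (x%:num <= y%:num).
Proof. by []. Qed.

Lemma i01_ge0 x : 0 <= x%:num.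
Proof. by []. Qed.

Lemma i01_le1 x : x%:num <= 1.
Proof. exact: (le_i01 x). Qed.

Lemma num_i01_min x y : (Num.min x y)%:num = Num.min x%:num y%:num.
Proof.
have ltE : (x < y) = (x%:num < y%:num) by [].
by rewrite /Order.min -ltE; case: ifP.
Qed.

Lemma num_i01_max x y : (Num.max x y)%:num = Num.max x%:num y%:num.
Proof.
have ltE : (x < y) = (x%:num < y%:num) by [].
by rewrite /Order.max -ltE; case: ifP.
Qed.

(** Since [z] is at most 1, truncation at 1 does not affect the bound. *)
Lemma le_oplusE z x y : (z <= oplus x y) = (z%:num <= x%:num + y%:num).
Proof.
suff: (z <= oplus x y) = (z%:num <= Num.min (x%:num + y%:num) 1).
  by move=> ->; rewrite le_min [X in _ && X](le_i01 z) andbT.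
by [].
Qed.

Lemma ominus_leE z x y : (ominus x y <= z) = (x%:num <= z%:num + y%:num).
Proof.
suff: (ominus x y <= z) = (Num.max (x%:num - y%:num) 0 <= z%:num).
  by move=> ->; rewrite ge_max lerBlDr ge0 andbT.
by [].
Qed.

Lemma le_ominusE x y : x%:num - y%:num <= (ominus x y)%:num.
Proof. by rewrite /= le_max lexx. Qed.

Lemma le_i01_eps (k : R) x y : 0 < k ->
  (forall e : {i01 R}, 0 < e%:num -> x%:num <= y%:num + k * e%:num) -> x <= y.
Proof.
move=> k0 xy; rewrite i01_leE; apply/ler_addgt0Pr => e e0.
have m0 : 0 < Num.min (e / k) 1 by rewrite lt_min ltr01 divr_gt0.
have m1 : Num.min (e / k) 1 <= 1 by rewrite ge_min lexx orbT.
apply: le_trans (xy (Itv01 (ltW m0) m1) m0) _.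
by rewrite lerD2l /= mulrC -ler_pdivlMr// ge_min lexx.
Qed.

Lemma ratr01_approx x (e : R) : 0 < e ->
  exists c : {i01 rat}, x <= ratr01 R c /\ (ratr01 R c)%:num <= x%:num + e.
Proof.
move=> e0; have [] := @rat_in_itvoo R x%:num (x%:num + e); first by rewrite ltrDl.
move=> q; rewrite in_itv /= => /andP[xq qe].
have q0 : 0 <= q by rewrite -(ler0q R) (le_trans _ (ltW xq)).
have [q1|q1] := leP q 1.
  by exists (Itv01 q0 q1); rewrite i01_leE /=; split; apply: ltW.
have ratr1 : ratr 1 = 1 :> R by rewrite rmorph1.
(* If [q] exceeds 1, the constant 1 takes its place: it bounds [x] and lies below [q]. *)
exists 1%:i01; rewrite i01_leE /= ratr1; split; first exact: i01_le1.
by apply: le_trans (ltW qe); rewrite -ratr1 ler_rat ltW.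
Qed.

End UnitIntervalArithmetic.

(** * Triangle inequalities for lax extensions *)

Section LaxExtensionTheory.
Variables (R : realType) (T : set_functor) (L : lax_extension R T).

Lemma lax_triangle (A B C : SET) (r : fuzzy_rel R A B) (s : fuzzy_rel R B C)
    (q : fuzzy_rel R A C) t u v :
    (forall a b c, (q a c)%:num <= (r a b)%:num + (s b c)%:num) ->
  (lax L q t v)%:num <= (lax L r t u)%:num + (lax L s u v)%:num.
Proof.
move=> qrs; rewrite -le_oplusE.
have qle : le_fuzzy q (comp_fuzzy r s).
  by move=> a c; apply: le_comp_fuzzy => b; rewrite le_oplusE.
apply: le_trans (lax_le L qle t v) _.
apply: le_trans (lax_comp L r s t v) _.
exact: ge_comp_fuzzy.
Qed.

Lemma lax_Delta_diag (A : SET) (t : T A) : lax L (Delta R A) t t <= 0%:i01.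
Proof.
rewrite -(GrE R (fmap T (@idfun A)) t) [X in Gr _ _ _ X]fmap_id.
exact: lax_Gr.
Qed.

Lemma lax_Delta_l (A B : SET) (r : fuzzy_rel R A B) t u v :
  (lax L r t v)%:num <= (lax L (Delta R A) t u)%:num + (lax L r u v)%:num.
Proof.
apply: lax_triangle => a b c; have := i01_le1 (r a c).
have := i01_ge0 (r b c); rewrite /Delta /Delta_eps /Gr_eps.
by case: asboolP => [/= ->|_ /=]; lra.
Qed.

Lemma lax_Delta_r (A B : SET) (r : fuzzy_rel R A B) t u v :
  (lax L r t v)%:num <= (lax L r t u)%:num + (lax L (Delta R B) u v)%:num.
Proof.
apply: lax_triangle => a b c; have := i01_le1 (r a c).
have := i01_ge0 (r a b); rewrite /Delta /Delta_eps /Gr_eps.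
by case: asboolP => [/= ->|_ /=]; lra.
Qed.

(** The hypothesis says that [r] lies below the composite of [Delta_eps e A] and [s], and
    nonexpansiveness bounds the first factor by [e] on the diagonal. *)
Lemma lax_nonexpansive (A B : SET) (r s : fuzzy_rel R A B) (e : {i01 R}) t v :
    nonexpansive L -> 0 < e%:num ->
    (forall a b, (r a b)%:num <= (s a b)%:num + e%:num) ->
  (lax L r t v)%:num <= (lax L s t v)%:num + e%:num.
Proof.
move=> hne e0 rs.
have De : (lax L (Delta_eps e A) t t)%:num <= e%:num.
  have := hne A e e0 t t.
  by rewrite {2}/Delta_eps /Gr_eps asboolT.
rewrite addrC; apply: le_trans (_ : _ <= (lax L (Delta_eps e A) t t)%:num + _) _.
  apply: (lax_triangle (s := s)) => a b c; have := i01_le1 (r a c).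
  have := rs a c; have := i01_ge0 (s b c).
  by rewrite /Delta_eps /Gr_eps; case: asboolP => [/= ->|_ /=]; lra.
exact: lerD.
Qed.

(** * Moss liftings through generic elements *)

Variable P : finitary_presentation T.

(** The Yoneda element of [o]: by naturality it determines the whole operation. *)
Definition generic_elem (o : operation P) : T 'I_(arity o) :=
  Tomega_incl (interp o _ id).

Lemma interp_generic (o : operation P) (X : SET) (x : 'I_(arity o) -> X) :
  Tomega_incl (interp o X x) = fmap T x (generic_elem o).
Proof. exact: (congr1 (@Tomega_incl T X) (nt_natural (interp o) x id)). Qed.

(** Pulling membership back along [f] replaces [Q R X] by the finite index set, so the lifting
    becomes an instance of [lax] to which the triangle inequalities apply. *)
Lemma moss_generic (o : operation P) (X : SET) (f : 'I_(arity o) -> Q R X) t :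
  moss L o X f t = lax L (fun x i => f i x) t (generic_elem o).
Proof.
rewrite /= /moss_fun interp_generic -{1}(fmap_id t).
by rewrite -(lax_natural L idfun f (elem_fuzzy R X)).
Qed.

Lemma finitary_approx (X : SET) (t : T X) (e : R) :
    finitarily_separable L -> 0 < e ->
  exists (o : operation P) (x : 'I_(arity o) -> X),
    (lax L (Delta R X) t (fmap T x (generic_elem o)))%:num <= e /\
    (lax L (Delta R X) (fmap T x (generic_elem o)) t)%:num <= e.
Proof.
move=> hsep e0; have [s] := hsep X t e e0.
by have [o [x ->]] := interp_surj P s; rewrite interp_generic; exists o, x.
Qed.

End LaxExtensionTheory.

Section Characterization.
Variables (R : realType) (T : set_functor) (L : lax_extension R T).
Variable P : finitary_presentation T.
Variables (A B : SET) (alpha : A -> T A) (beta : B -> T B).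

Local Notation form := (formula (moss_liftings L P)).

Lemma eval_FMinus (C : SET) (gamma : C -> T C) (phi : form) k c :
  eval gamma (FMinus phi k) c = ominus (eval gamma phi c) (ratr01 R k).
Proof. by []. Qed.

Lemma eval_FAnd (C : SET) (gamma : C -> T C) (phi psi : form) c :
  eval gamma (FAnd phi psi) c = Num.min (eval gamma phi c) (eval gamma psi c).
Proof. by []. Qed.

Lemma eval_FOr (C : SET) (gamma : C -> T C) (phi psi : form) c :
  eval gamma (FOr phi psi) c = Num.max (eval gamma phi c) (eval gamma psi c).
Proof. by []. Qed.

Lemma eval_FModal_moss (C : SET) (gamma : C -> T C) (o : operation P)
    (Lo : moss_liftings L P (moss L o)) (psi : 'I_(arity o) -> form) c :
  eval gamma (FModal Lo psi) c =
  lax L (fun x i => eval gamma (psi i) x) (gamma c) (generic_elem o).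
Proof. exact: moss_generic. Qed.

Local Notation d := (logical_distance (moss_liftings L P) alpha beta).

(** * Adequacy *)

Lemma eval_simulation (r : fuzzy_rel R A B) (phi : form) :
    simulation L alpha beta r ->
  forall a b, (eval alpha phi a)%:num <= (r a b)%:num + (eval beta phi b)%:num.
Proof.
move=> simr; elim: phi => [c|phi IH c|phi IH c|phi IH psi IH'|phi IH psi IH'|].
- by move=> a b /=; rewrite lerDr.
- move=> a b /=; have := IH a b; have := i01_ge0 (r a b).
  by rewrite /= /Num.max; do 2 case: ltP => ?; lra.
- move=> a b /=; have := IH a b; have := i01_ge0 (r a b).
  by rewrite /= /Num.min; do 2 case: ltP => ?; lra.
- move=> a b; have := IH a b; have := IH' a b.
  rewrite !eval_FAnd !num_i01_min.
  by case: (leP (eval alpha phi a)%:num (eval alpha psi a)%:num);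
    case: (leP (eval beta phi b)%:num (eval beta psi b)%:num); lra.
- move=> a b; have := IH a b; have := IH' a b.
  rewrite !eval_FOr !num_i01_max.
  by case: (leP (eval alpha phi a)%:num (eval alpha psi a)%:num);
    case: (leP (eval beta phi b)%:num (eval beta psi b)%:num); lra.
- move=> l Ll phi IH a b; case: (Ll) => o lE; subst l.
  rewrite !eval_FModal_moss.
  apply: le_trans (_ : _ <= (lax L r (alpha a) (beta b))%:num + _) _.
    (* The induction hypotheses for all arguments form one triangle inequality, with the argument
       index [i] as third point. *)
    apply: lax_triangle => x y i; exact: IH.
  by rewrite lerD2r; exact: simr.
Qed.

(** * Formulae nearly attaining the logical distance *)

Lemma logical_distance_lb (phi : form) a b :
  (eval alpha phi a)%:num <= (d a b)%:num + (eval beta phi b)%:num.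
Proof. by rewrite -ominus_leE; apply: le_sup01; exists phi. Qed.

Definition FBot : form := FConst _ 0%:i01.

Lemma eval_FBot (C : SET) (gamma : C -> T C) c :
  eval gamma FBot c = 0%:i01.
Proof. by apply/val_inj; rewrite /= rmorph0. Qed.

Lemma logical_distance_witness a b (e : R) : 0 < e ->
  exists phi : form,
    (d a b)%:num <= (eval alpha phi a)%:num - (eval beta phi b)%:num + e.
Proof.
move=> e0; apply: contrapT => /forallNP nphi.
have phi_de (phi : form) :
    (eval alpha phi a)%:num - (eval beta phi b)%:num <= (d a b)%:num - e.
  by move: (nphi phi) => /negP; rewrite -ltNge; lra.
(* The bound must itself lie in the unit interval to compete with the supremum; [FBot] shows that it
   is nonnegative. *)
have de0 : 0 <= (d a b)%:num - e.
  by have := phi_de FBot; rewrite !eval_FBot subrr.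
have de1 : (d a b)%:num - e <= 1.
  by have := i01_le1 (d a b); lra.
suff le_de : d a b <= Itv01 de0 de1.
  have : (d a b)%:num <= (d a b)%:num - e := le_de.
  by lra.
apply: ge_sup01 => _ [phi ->]; rewrite ominus_leE.
by rewrite -lerBlDr; exact: phi_de.
Qed.

Definition FBigOr (m : nat) (f : 'I_m -> form) : form :=
  \big[@FOr R T _/FBot]_(i < m) f i.

Lemma le_eval_FBigOr (C : SET) (gamma : C -> T C) m (f : 'I_m -> form) i c :
  eval gamma (f i) c <= eval gamma (FBigOr f) c.
Proof.
rewrite /FBigOr; elim: m f i => [f []//|m IH f i].
rewrite big_ord_recl eval_FOr le_max.
have [j ->|->] := unliftP ord0 i; last by rewrite lexx.
by rewrite IH orbT.
Qed.

Lemma eval_FBigOr_le (C : SET) (gamma : C -> T C) m (f : 'I_m -> form) c x :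
  (forall i, eval gamma (f i) c <= x) -> eval gamma (FBigOr f) c <= x.
Proof.
rewrite /FBigOr; elim: m f => [f _|m IH f fx].
  by rewrite big_ord0 eval_FBot i01_leE; exact: i01_ge0.
by rewrite big_ord_recl eval_FOr ge_max fx IH.
Qed.

(* Truncating a near-optimal formula for [(a, b)] by a rational just above its
   value at [b] makes it vanish at [b] without losing much at [a]. *)
Lemma logical_distance_witness0 a b (e : R) : 0 < e ->
  exists phi : form,
    (d a b)%:num <= (eval alpha phi a)%:num + e /\ eval beta phi b <= 0%:i01.
Proof.
move=> e0; have e20 : 0 < e / 2 by rewrite divr_gt0.
have [phi dphi] := logical_distance_witness a b e20.
have [c [phic cphi]] := ratr01_approx (eval beta phi b) e20.
exists (FMinus phi c); rewrite !eval_FMinus; split; last first.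
  by rewrite ominus_leE add0r.
by have := le_ominusE (eval alpha phi a) (ratr01 R c); lra.
Qed.

(** The disjunction of the witnesses dominates each of them and still vanishes at [b]. *)
Lemma logical_distance_witness_finite m (x : 'I_m -> A) b (e : R) : 0 < e ->
  exists psi : form,
    (forall i, (d (x i) b)%:num <= (eval alpha psi (x i))%:num + e) /\
    eval beta psi b <= 0%:i01.
Proof.
move=> e0; have [f fP] := choice (fun i => logical_distance_witness0 (x i) b e0).
exists (FBigOr f); split=> [i|]; last first.
  by apply: eval_FBigOr_le => i; have [] := fP i.
have [df _] := fP i; apply: le_trans df _.
by rewrite lerD2r; exact: le_eval_FBigOr.
Qed.

(** * Expressivity *)

Lemma logical_distance_simulation :
  finitarily_separable L -> nonexpansive L -> simulation L alpha beta d.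
Proof.
(* Four errors [e] come from the approximations, each used in both directions, and one from the
   witnesses. *)
move=> hsep hne a b; apply: (@le_i01_eps R 5) => // e e0.
have [o' [x [tx xt]]] := finitary_approx P (alpha a) hsep e0.
have [o [y [ty yt]]] := finitary_approx P (beta b) hsep e0.
have [psi psiP] :=
  choice (fun j => logical_distance_witness_finite x (y j) e0).
set s' := fmap T x (generic_elem o') in tx xt.
set s := fmap T y (generic_elem o) in ty yt.
pose psiA : fuzzy_rel R A 'I_(arity o) := fun c j => eval alpha (psi j) c.
pose psiB : fuzzy_rel R B 'I_(arity o) := fun c j => eval beta (psi j) c.
have dss : (lax L d s' s)%:num <=
    (lax L psiA s' (generic_elem o))%:num + e%:num.
  (* Both relations are pulled back to finite index sets, the only place where the witnesses control
     [d]. *)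
  rewrite -(lax_natural L x y d) -[X in lax L psiA _ X]fmap_id.
  rewrite -(lax_natural L x idfun psiA).
  by apply: lax_nonexpansive => // i j; have [dpsi _] := psiP j; exact: dpsi.
have psiBs : (lax L psiB s (generic_elem o))%:num <= 0.
  rewrite -[X in lax L psiB _ X]fmap_id -(lax_natural L y idfun psiB).
  apply: le_trans (lax_Delta_diag L (generic_elem o)).
  apply: lax_le => i j; rewrite /Delta /Delta_eps /Gr_eps.
  (* Off the diagonal [Delta] is 1; on it, [psi j] vanishes at [y j]. *)
  case: asboolP => [/= ->|_]; last exact: le_i01.
  by have [_] := psiP j.
have := logical_distance_lb (FModal (ex_intro _ o erefl : moss_liftings L P _) psi) a b.
rewrite !eval_FModal_moss.
have := lax_Delta_l L d (alpha a) s' (beta b).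
have := lax_Delta_r L d s' s (beta b).
have := lax_Delta_l L psiA s' (alpha a) (generic_elem o).
have := lax_Delta_l L psiB (beta b) s (generic_elem o).
rewrite -/psiA -/psiB; lra.
Qed.

End Characterization.

Theorem corollary8p10 (R : realType) (T : set_functor)
  (L : lax_extension R T) (P : finitary_presentation T)
  (hsep : finitarily_separable L) (hne : nonexpansive L)
  (A B : SET) (alpha : A -> T A) (beta : B -> T B) (a : A) (b : B) :
  behavioural_distance L alpha beta a b =
  logical_distance (moss_liftings L P) alpha beta a b.
Proof.
apply: i01_anti.
  apply: ge_inf01.
  by exists (logical_distance (moss_liftings L P) alpha beta) => //;
    exact: logical_distance_simulation.
apply: le_inf01 => _ [r simr <-]; apply: ge_sup01 => _ [phi ->].
by rewrite ominus_leE; exact: eval_simulation.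
Qed.
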